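(* For every $\delta>0$ there exists $n_0$ such that every triangle-free graph $G$ on $n\ge n_0$ vertices satisfies $$\chi_f(G)\le (\sqrt{2}+\delta)\sqrt{\frac{n}{\ln n}}.$$
   Context: The fractional chromatic number $\chi_f(G)$ of a finite graph $G$ is the minimum real number $r\ge 1$ such that there exists a probability distribution on the independent sets of $G$ under which a random independent set contains every vertex $v\in V(G)$ with probability at least $1/r$. A graph is triangle-free if it contains no three pairwise adjacent vertices. *)

(* Defs.v *)
From HB Require Import structures.
From mathcomp Require Import all_boot all_order all_algebra.
From mathcomp Require Import all_classical all_reals all_analysis.

Set Implicit Arguments.
Unset Strict Implicit.
Unset Printing Implicit Defensive.

Import Order.TTheory GRing.Theory Num.Theory.
Import numFieldNormedType.Exports.

Local Open Scope classical_set_scope.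
Local Open Scope ring_scope.

(* A finite simple graph is a symmetric irreflexive relation on a finType. *)

(* For irreflexive e, the three vertices are automatically distinct. *)
Definition triangle_free (T : finType) (e : rel T) : Prop :=
  forall x y z : T, ~ [/\ e x y, e y z & e x z].

Definition independent (T : finType) (e : rel T) (A : {set T}) : Prop :=
  forall x y : T, x \in A -> y \in A -> ~~ e x y.

Definition independent_dist (R : realType) (T : finType) (e : rel T)
    (P : {set T} -> R) : Prop :=
  [/\ forall A, 0 <= P A,
      \sum_(A : {set T}) P A = 1
    & forall A, ~ independent e A -> P A = 0].

Definition fractionally_colorable (R : realType) (T : finType) (e : rel T)
    (r : R) : Prop :=
  1 <= r /\
  exists2 P : {set T} -> R, independent_dist e P
    & forall v : T, r^-1 <= \sum_(A : {set T} | v \in A) P A.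

(* The infimum is a minimum: see fractional_chromatic_number_min below. *)
Definition fractional_chromatic_number (R : realType) (T : finType)
    (e : rel T) : R :=
  inf [set r : R | fractionally_colorable e r].

Lemma fractionally_colorable_has_inf (R : realType) (T : finType)
    (e : rel T) (e_irr : irreflexive e) :
  has_inf [set r : R | fractionally_colorable e r].
Proof.
split; last by exists 1 => r [].
have [T0|T0] := posnP #|T|.
  exists 1; split=> //; exists (fun A => (A == finset.set0)%:R); last first.
    by move=> v; move: (fintype0 v T0).
  split=> [A||A nA]; first exact: ler0n.
  - rewrite (bigD1 finset.set0) //= eqxx big1 ?addr0 // => A /negbTE ->.
    by [].
  - by case: eqP => // A0; case: nA => x; move: (fintype0 x T0).
have n0 : #|T|%:R != 0 :> R by rewrite pnatr_eq0 -lt0n.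
exists #|T|%:R; split; first by rewrite ler1n.
exists (fun A => \sum_(v : T) (A == finset.set1 v)%:R / #|T|%:R).
  split=> [A||A nA].
  - by apply: sumr_ge0 => v _; rewrite divr_ge0.
  - rewrite exchange_big /= (eq_bigr (fun=> #|T|%:R^-1)).
      by rewrite sumr_const -[LHS]mulr_natl mulfV.
    move=> v _; rewrite (bigD1 (finset.set1 v)) //= eqxx mul1r big1 ?addr0 //.
    by move=> A /negbTE ->; rewrite mul0r.
  - apply: big1 => v _; case: eqP => [Av|]; last by rewrite mul0r.
    by case: nA => x y; rewrite Av !inE => /eqP -> /eqP ->; rewrite e_irr.
move=> v; rewrite (bigD1 (finset.set1 v)) ?inE //= -[leLHS]addr0 lerD //.
  rewrite (bigD1 v) //= eqxx mul1r -[leLHS]addr0 lerD //.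
  by apply: sumr_ge0 => w _; rewrite divr_ge0.
by apply: sumr_ge0 => A _; apply: sumr_ge0 => w _; rewrite divr_ge0.
Qed.

Lemma sum_coord_continuous (R : realType) (T : finType) (p : pred {set T}) :
  continuous (fun P : prod_topology (fun _ : {set T} => R : topologicalType) =>
    \sum_(A : {set T} | p A) P A : R).
Proof.
apply: (@continuous_big R {set T} +%R 0 p (@add_continuous R)
  (prod_topology (fun _ : {set T} => R : topologicalType)) _
  (fun A P => P A)).
by move=> A _; exact: (@proj_continuous {set T} (fun=> R : topologicalType) A).
Qed.

Lemma fractional_chromatic_number_min (R : realType) (T : finType)
    (e : rel T) (e_irr : irreflexive e) :
  fractionally_colorable e (fractional_chromatic_number R e) /\
  (forall r : R, fractionally_colorable e r ->
    fractional_chromatic_number R e <= r).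
Proof.
have S_inf := fractionally_colorable_has_inf R e_irr.
rewrite /fractional_chromatic_number; set S := [set _ | _] in S_inf *.
set r0 := inf S.
split; last by move=> r Sr; apply: ge_inf => //; case: S_inf.
have r0_ge1 : 1 <= r0 by apply: lb_le_inf; [case: S_inf | move=> r []].
have r0_gt0 : 0 < r0 by exact: lt_le_trans r0_ge1.
split=> //.
have /choice[P PP] (n : nat) : exists P : {set T} -> R,
    independent_dist e P /\
    forall v, (r0 + n.+1%:R^-1)^-1 <= \sum_(A : {set T} | v \in A) P A.
  have n_gt0 : 0 < n.+1%:R^-1 :> R by rewrite invr_gt0.
  have [r [r_ge1 [P Pd Pv]] rlt] := inf_adherent n_gt0 S_inf.
  exists P; split=> // v; apply: le_trans (Pv v).
  rewrite lef_pV2 ?posrE ?(ltW rlt) ?addr_gt0 //.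
  exact: lt_le_trans r_ge1.
pose X := prod_topology (fun _ : {set T} => R : topologicalType).
have cubeP : compact [set f : X | forall A, `[0 : R, 1]%classic (f A)].
  exact: (@tychonoff _ (fun=> R : topologicalType) (fun=> `[0, 1]%classic)
    (fun=> @segment_compact R 0 1)).
have Fcube : ((P : nat -> X) @ \oo)
    [set f : X | forall A, `[0 : R, 1]%classic (f A)].
  exists 0%N => // n _ A; have [[P0 P1 _] _] := PP n.
  rewrite /= in_itv /= P0 /= -P1 (bigD1 A) //= lerDl.
  by apply: sumr_ge0 => B _; exact: P0.
have [Q [_ clQ]] := cubeP _ _ Fcube.
have lim_closed (p : pred {set T}) (D : set R) : closed D ->
    (\forall n \near \oo, D (\sum_(A | p A) P n A)) -> D (\sum_(A | p A) Q A).
  move=> Dcl PD.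
  have Ccl := preimage_closed (fun x _ => @sum_coord_continuous R T p x) Dcl.
  by apply: Ccl => B nB; apply: clQ.
have lim1 (A : {set T}) (D : set R) : closed D ->
    (forall n, D (P n A)) -> D (Q A).
  move=> Dcl PD; have := lim_closed (pred1 A) D Dcl.
  rewrite big_pred1_eq; apply; near=> n; rewrite big_pred1_eq; exact: PD.
exists Q.
  split=> [A||A nA].
  - have := lim1 A _ (@closed_ge R 0); apply=> n.
    by have [[+ _ _] _] := PP n; apply.
  - have := lim_closed xpredT _ (@closed_eq R 1); apply.
    by exists 0%N => // n _; have [[]] := PP n.
  - have := lim1 A _ (@closed_eq R 0); apply=> n.
    by have [[_ _ +] _] := PP n; apply.
move=> v; have cvgr : (r0 + n.+1%:R^-1)^-1 @[n --> \oo] --> r0^-1.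
  apply: cvgV; first by rewrite gt_eqF.
  rewrite -[X in _ --> X]addr0; apply: cvgD; first exact: cvg_cst.
  exact: cvg_harmonic.
rewrite leNgt; apply/negP => lt.
pose c := (\sum_(A : {set T} | v \in A) Q A + r0^-1) / 2.
have [c1 c2] := midf_lt lt.
have := lim_closed (fun A => v \in A) _ (@closed_ge R c).
have /[swap] /[apply] : \forall n \near \oo,
    c <= \sum_(A : {set T} | v \in A) P n A.
  near=> n; have [_ /(_ v)] := PP n; apply: le_trans; apply: ltW.
  by near: n; exact: (cvgr_gt _ cvgr).
by rewrite /= leNgt c1.
Unshelve. all: by end_near. Qed.

(* Main.v *)
(** By linear programming duality it suffices to find, for every weighting [c]
    of the vertices, an independent set of weight at least [c(V) / r], where
    [r] is the claimed bound.

    The heart is a weighted form of Shearer's theorem.  Give vertex [v] a rate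
    [x_v = exp (- z_v)] with [0 <= z_v <= Z], let [d_v] be the sum of the rates
    of its neighbours, and put [Phi z = sum_v c_v x_v z_v / (d_v + s)].  Choose
    [z] maximising [Phi] on the box.  A vertex with [z_v = 0] contributes
    nothing and can be deleted.  Otherwise, raising the rates does not increase
    [Phi], and this first-order condition, the convexity of [1 / (d + s)] and
    triangle-freeness show that if [u] is drawn with probability proportional
    to [x_u], the expected drop of [Phi] on deleting the closed neighbourhood of
    [u] is at most [1 + 2 Z / s] times the expectation of [c_u].  So some [u]
    can be put in the independent set, and one inducts.

    At [z = Z] this gives weight at least about [Z sum_v c_v / (deg v + S)] with
    [S = 2 Z exp Z / eps].  Neighbourhoods are independent; if all of them have
    weight at most [t c(V)], then the [c]-average degree is at most [n t], and
    Jensen's inequality gives [t (n t + S) >= Z] up to a factor [1 + eps].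
    Taking [Z] slightly below [ln n / 2] makes [S] negligible against
    [n t], whence [t >= sqrt (ln n / (2 n))] asymptotically. *)

Require Import Defs.
From mathcomp Require Import all_boot all_order all_algebra.
From mathcomp Require Import all_classical all_reals all_analysis.
From mathcomp Require Import ring lra.

Import Order.TTheory GRing.Theory Num.Theory.
Import numFieldNormedType.Exports.

Local Open Scope ring_scope.

(** * Linear programming duality by a compactness argument *)

Lemma le0_of_le_small (R : realFieldType) (a b t0 : R) : 0 < t0 ->
  (forall t, 0 < t -> t <= t0 -> a <= t * b) -> a <= 0.
Proof.
move=> t0_gt0 H; rewrite leNgt; apply/negP => a_gt0.
have b_gt0 : 0 < b.
  have := H t0 t0_gt0 (lexx _); rewrite leNgt => /negP nlt.
  rewrite ltNge; apply/negP => b_le0; apply: nlt.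
  by apply: le_lt_trans a_gt0; rewrite pmulr_rle0.
pose t := Num.min t0 (a / b / 2).
have t_gt0 : 0 < t by rewrite lt_min t0_gt0 !divr_gt0.
have t_le : t <= t0 by rewrite ge_min lexx.
have := H t t_gt0 t_le; rewrite leNgt => /negP; apply.
apply: (@le_lt_trans _ _ (a / b / 2 * b)).
  by rewrite ler_pM2r // ge_min lexx orbT.
rewrite mulrAC divfK ?gt_eqF // ltr_pdivrMr //.
by rewrite ltr_pMr // ltr1n.
Qed.

(** The right side is the square of [Num.max 0 a - h]; the bound replaces differentiating the
    squared positive part. *)
Lemma sqr_max0B_le (R : realFieldType) (a h : R) :
  Num.max 0 (a - h) ^+ 2 <= Num.max 0 a ^+ 2 - 2 * h * Num.max 0 a + h ^+ 2.
Proof.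
have -> : Num.max 0 a ^+ 2 - 2 * h * Num.max 0 a + h ^+ 2 =
    (Num.max 0 a - h) ^+ 2 by ring.
case: (leP 0 a) => a0; case: (leP 0 (a - h)) => h0 //.
- by rewrite expr0n /= sqr_ge0.
- by rewrite sub0r sqrrN -sqrrN lerXn2r ?nnegrE //; lra.
- by rewrite expr0n /= sqr_ge0.
Qed.

Lemma continuous_sqr_max0B (R : realType) (t : R) :
  continuous (fun x : R => Num.max 0 (t - x) ^+ 2).
Proof.
move=> x; apply: (@continuous_comp R R R (fun y => Num.max 0 (t - y))
  (fun y => y ^+ 2)); last exact: exprn_continuous.
apply: (@continuous_max R R (fun=> 0) (fun y => t - y)).
  exact: cst_continuous.
by apply: continuousB; [exact: cst_continuous | exact: cvg_id].
Qed.

Section Product.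
Local Open Scope classical_set_scope.
Context {R : realType} {I : finType}.
Let X := prod_topology (fun _ : I => R : topologicalType).

Lemma prodtop_coord_continuous (i : I) : continuous (fun f : X => f i : R).
Proof. exact: (@proj_continuous I (fun=> R : topologicalType) i). Qed.

Lemma prodtop_sum_continuous (J : finType) (p : pred J) (F : J -> X -> R) :
  (forall j, p j -> continuous (F j)) ->
  continuous (fun f : X => \sum_(j | p j) F j f : R).
Proof.
exact: (@continuous_big R J +%R 0 p (@add_continuous R) X _ F).
Qed.

Lemma box_compact (a b : R) :
  compact [set f : X | forall i, a <= f i <= b].
Proof.
have := @tychonoff I (fun=> R : topologicalType) (fun=> `[a, b]%classic)
  (fun=> @segment_compact R a b).
congr compact; apply/seteqP; split=> f /= fP i; have := fP i;
  by rewrite /= in_itv.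
Qed.

End Product.

Lemma independent_dist_compact (R : realType) (T : finType) (e : rel T) :
  compact ([set P | independent_dist e P]%classic :
    set (prod_topology (fun _ : {set T} => R : topologicalType))).
Proof.
apply: (@subclosed_compact _ _ _ _ (@box_compact R {set T} 0 1)); last first.
  move=> P [P0 P1 _] A; rewrite P0 /= -P1 (bigD1 A) //= lerDl.
  by apply: sumr_ge0 => B _; exact: P0.
pose X := prod_topology (fun _ : {set T} => R : topologicalType).
have -> : [set P | independent_dist e P]%classic =
    (\bigcap_(A in setT) [set P : X | 0 <= P A] `&`
     [set P : X | \sum_A P A = 1] `&`
     \bigcap_(A in [set A | ~ independent e A]) [set P : X | P A = 0])%classic.
  apply/seteqP; split=> P /=.
    move=> [P0 P1 P2]; split=> [|A]; last exact: P2.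
    by split=> // A _; exact: P0.
  by move=> [[P0 P1] P2]; split=> // A; exact: P0.
apply: closedI; first apply: closedI.
- apply: closed_bigI => A _; apply: (preimage_closed _ (@closed_ge R 0)).
  by move=> P _; exact: prodtop_coord_continuous.
- apply: (preimage_closed _ (@closed_eq R 1)).
  by move=> P _; exact: (@sum_coord_continuous R T xpredT).
- apply: closed_bigI => A _; apply: (preimage_closed _ (@closed_eq R 0)).
  by move=> P _; exact: prodtop_coord_continuous.
Qed.

(* The distribution minimises the squared shortfalls [max 0 (t - P(v in A))];
   these shortfalls are the weights to which the hypothesis is applied. *)
Lemma independent_dist_of_weights (R : realType) (T : finType) (e : rel T)
    (t : R) :
  (forall c : T -> R, (forall v, 0 <= c v) ->
    exists2 A : {set T}, independent e A & t * \sum_v c v <= \sum_(v in A) c v) ->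
  exists2 P : {set T} -> R, independent_dist e P
    & forall v, t <= \sum_(A : {set T} | v \in A) P A.
Proof.
move=> H.
pose X := prod_topology (fun _ : {set T} => R : topologicalType).
pose p (P : X) v : R := \sum_(A : {set T} | v \in A) P A.
pose f (P : X) : R := \sum_v Num.max 0 (t - p P v) ^+ 2.
have dist1 (A : {set T}) : independent e A ->
    independent_dist e (fun B => (B == A)%:R : R).
  move=> iA; split=> [B||B nB]; first exact: ler0n.
    by rewrite (bigD1 A) //= eqxx big1 ?addr0 // => B /negbTE ->.
  by case: eqP nB => // -> /(_ iA).
have p1 A v : p (fun B => (B == A)%:R) v = (v \in A)%:R.
  rewrite /p; case: (boolP (v \in A)) => vA.
    rewrite (bigD1 A) //= eqxx big1 ?addr0 // => B /andP[_ /negbTE ->] //.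
  by rewrite big1 // => B vB; case: eqP => // BA; rewrite BA (negbTE vA) in vB.
have cf : continuous f.
  pose g (x : R) : R := Num.max 0 (t - x) ^+ 2.
  apply: prodtop_sum_continuous => v _ P; apply: (@continuous_comp X R R (p^~ v) g).
    exact: sum_coord_continuous.
  exact: continuous_sqr_max0B.
have D0 : ([set P : X | independent_dist e P] !=set0)%classic.
  by have [A iA _] := H (fun=> 0) (fun=> lexx _); exists (fun B => (B == A)%:R);
    exact: dist1.
have [P /set_mem Pd Pmin] := compact_EVT_min D0 (@independent_dist_compact R T e)
  (continuous_subspaceT cf).
exists P => // v0.
have [P0 P1 P2] := Pd.
pose c v : R := Num.max 0 (t - p P v).
have c_ge0 v : 0 <= c v by rewrite le_max lexx.
have p01 v : 0 <= p P v <= 1.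
  rewrite sumr_ge0 //= -P1 [leRHS](bigID (fun A : {set T} => v \in A)) /= lerDl.
  exact: sumr_ge0.
have [A iA cA] := H c c_ge0.
pose D v : R := (v \in A)%:R - p P v.
have cD : \sum_v c v * D v <= 0.
  (* Moving a fraction [s] of the mass of [P] to the point mass at [A] changes each [p P v] by
     [s * D v]. Minimality of [P] and [|D v| <= 1] bound the sum by [s * (#|T| / 2)]; then [s] tends
     to 0. *)
  apply: (@le0_of_le_small _ _ (#|T|%:R / 2) 1) => // s s0 s1.
  pose Q : X := fun B => P B + s * ((B == A)%:R - P B).
  have Qd : independent_dist e Q.
    have [A0 A1 A2] := dist1 A iA.
    split=> [B||B nB]; last by rewrite /Q A2 ?P2 // subrr mulr0 addr0.
      have -> : Q B = (1 - s) * P B + s * (B == A)%:R by rewrite /Q; ring.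
      by rewrite addr_ge0 // mulr_ge0 ?subr_ge0 // ltW.
    by rewrite big_split /= -mulr_sumr big_split /= sumrN A1 P1 subrr mulr0 addr0.
  have pQ v : p Q v = p P v + s * D v.
    by rewrite /D -p1 /p big_split /= -mulr_sumr big_split /= sumrN.
  have := Pmin Q (mem_set Qd); rewrite -subr_ge0 /f -sumrB => fQ.
  have : \sum_v (Num.max 0 (t - p Q v) ^+ 2 - Num.max 0 (t - p P v) ^+ 2)
      <= \sum_v (s ^+ 2 - 2 * s * (c v * D v)).
    apply: ler_sum => v _; rewrite -/(c v) pQ.
    have D1 : (s * D v) ^+ 2 <= s ^+ 2.
      rewrite exprMn -[leRHS]mulr1 ler_wpM2l ?sqr_ge0 //.
      rewrite -real_normK ?num_real // exprn_ile1 // ler_norml.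
      by have := p01 v; rewrite /D; case: (v \in A) => /=; lra.
    have := @sqr_max0B_le R (t - p P v) (s * D v).
    rewrite -/(c v) opprD addrA; lra.
  rewrite [leRHS]big_split /= sumr_const sumrN -mulr_sumr -[s ^+ 2 *+ _]mulr_natl.
  move/(le_trans fQ) => {fQ}; rewrite -[#|_|]/#|T|.
  move: (\sum_v c v * D v) (#|T|%:R) => S N h.
  have : 0 <= s * (s * (N / 2) - S).
    have -> : s * (s * (N / 2) - S) = (N * s ^+ 2 - 2 * s * S) / 2 by field.
    by rewrite divr_ge0.
  by rewrite pmulr_rge0 // subr_ge0.
rewrite leNgt; apply/negP => v0lt.
have cv0 : 0 < c v0 by rewrite lt_max subr_gt0 v0lt orbT.
(* [c v] vanishes wherever [p P v >= t], so the shortfall at [v0] makes this sum negative, whereas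
   [cA] and [cD] make it nonnegative. *)
have : \sum_v c v * (p P v - t) < 0.
  rewrite (bigD1 v0) //= -[ltRHS]addr0 ltr_leD //.
    by rewrite pmulr_rlt0 // subr_lt0.
  apply: sumr_le0 => v _; rewrite /c; case: (leP 0 (t - p P v)) => h;
    last by rewrite mul0r.
  by rewrite mulr_ge0_le0 // -oppr_ge0 opprB.
apply/negP; rewrite -leNgt.
have -> : \sum_v c v * (p P v - t) =
    (\sum_(v in A) c v - t * \sum_v c v) - \sum_v c v * D v.
  rewrite [X in X - _ - _]big_mkcond /= mulr_sumr -!sumrB; apply: eq_bigr => v _.
  rewrite /D; case: (v \in A) => /=; ring.
by rewrite subr_ge0 (le_trans cD) // subr_ge0.
Qed.

(** * The potential and its decrease under deletion of closed neighbourhoods *)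

Lemma invD_ge_tangent (R : realFieldType) (D h : R) : 0 < D -> 0 < D + h ->
  D^-1 - h / D ^+ 2 <= (D + h)^-1.
Proof.
move=> D0 Dh0; rewrite -subr_ge0.
have -> : (D + h)^-1 - (D^-1 - h / D ^+ 2) = h ^+ 2 / (D ^+ 2 * (D + h)).
  by field; rewrite !gt_eqF.
by rewrite divr_ge0 ?sqr_ge0 // mulr_ge0 ?sqr_ge0 // ltW.
Qed.

Lemma expR_le_quadratic (R : realType) (t : R) : 0 <= t -> t <= 2^-1 ->
  expR t - 1 <= t * (1 + 2 * t).
Proof.
move=> t0 t1; have t1' : 0 < 1 - t by lra.
have : expR t <= (1 - t)^-1.
  rewrite -[leLHS]invrK -expRN lef_pV2 ?posrE ?expR_gt0 //.
  exact: expR_ge1Dx.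
have : (1 - t)^-1 <= 1 + t * (1 + 2 * t).
  rewrite -[leLHS]mul1r ler_pdivrMr // -subr_ge0.
  have -> : (1 + t * (1 + 2 * t)) * (1 - t) - 1 = t ^+ 2 * (1 - 2 * t) by ring.
  by rewrite mulr_ge0 ?sqr_ge0 //; lra.
lra.
Qed.

(** Double counting of the ordered adjacent pairs inside [S]. *)
Lemma adj_sum_exchange (R : comPzRingType) (T : finType) (e : rel T)
    (S : {set T}) (f g : T -> R) : symmetric e ->
  \sum_(u in S) f u * \sum_(v in S | e u v) g v =
  \sum_(v in S) g v * \sum_(u in S | e v u) f u.
Proof.
move=> esym; under eq_bigr do rewrite big_mkcondr mulr_sumr.
rewrite exchange_big /=; apply: eq_bigr => v _.
rewrite big_mkcondr mulr_sumr; apply: eq_bigr => u _.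
by rewrite esym; case: ifP => _; rewrite ?mulr0 // mulrC.
Qed.

Section Potential.
Context {R : realType} {T : finType}.
Variables (e : rel T) (c : T -> R) (s : R).
Hypotheses (e_sym : symmetric e) (e_irr : irreflexive e).
Hypotheses (e_tri : triangle_free e) (c_ge0 : forall v, 0 <= c v) (s_gt0 : 0 < s).
Implicit Types (S : {set T}) (z : T -> R) (u v y : T).

(* [z v = - ln x_v] where [x_v] is the rate of [v]; in this coordinate the
   potential is continuous on the whole space. *)
Definition wdeg S z v : R := \sum_(u in S | e v u) expR (- z u).

Definition potential S z : R :=
  \sum_(v in S) c v * (expR (- z v) * z v) / (wdeg S z v + s).

(* The weight with which the potential reacts to a decrease of [wdeg S z v]. *)
Definition dpotential S z v : R :=
  c v * (expR (- z v) * z v) / (wdeg S z v + s) ^+ 2.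

Lemma wdeg_ge0 S z v : 0 <= wdeg S z v.
Proof. by apply: sumr_ge0 => u _; exact: expR_ge0. Qed.

Lemma wdegD_gt0 S z v : 0 < wdeg S z v + s.
Proof. by rewrite ltr_wpDl // wdeg_ge0. Qed.

Lemma potential_continuous S :
  continuous (fun z : prod_topology (fun _ : T => R : topologicalType) =>
    potential S z).
Proof.
pose X := prod_topology (fun _ : T => R : topologicalType).
have cx v : continuous (fun z : X => expR (- z v) : R).
  move=> z; apply: (@continuous_comp X R R (fun z => z v) (fun r => expR (- r))).
    exact: (@prodtop_coord_continuous R T v).
  apply: (@continuous_comp R R R -%R expR); first exact: opp_continuous.
  exact: continuous_expR.
have cn v : continuous (fun z : X => c v * (expR (- z v) * z v) : R).
  move=> z; apply: (@continuousM R X (fun=> c v) (fun z => expR (- z v) * z v)).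
    exact: cst_continuous.
  apply: (@continuousM R X (fun z => expR (- z v)) (fun z => z v)); first exact: cx.
  exact: (@prodtop_coord_continuous R T v).
have cd v : continuous (fun z : X => wdeg S z v + s : R).
  move=> z; apply: (@continuousD R R X (fun z => wdeg S z v) (fun=> s)).
    by apply: (@prodtop_sum_continuous R T T (fun u => (u \in S) && e v u)) => u _;
      exact: cx.
  exact: cst_continuous.
apply: (@prodtop_sum_continuous R T T (fun v => v \in S)) => v _ z.
apply: (@continuousM R X (fun z => c v * (expR (- z v) * z v))
  (fun z => (wdeg S z v + s)^-1)); first exact: cn.
by apply: continuousV; [rewrite gt_eqF ?wdegD_gt0 | exact: cd].
Qed.

(** The term of [v] is zero, and deleting [v] can only shrink the denominators of the others. *)
Lemma potential_drop S z v : v \in S -> (forall u, 0 <= z u) -> z v = 0 ->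
  potential S z <= potential (S :\ v) z.
Proof.
move=> vS z0 zv; rewrite /potential (big_setD1 v) //= zv !mulr0 mul0r add0r.
apply: ler_sum => u _; apply: ler_wpM2l.
  by rewrite !mulr_ge0 ?expR_ge0.
rewrite lef_pV2 ?posrE ?wdegD_gt0 // lerD2r /wdeg [leRHS](bigID (mem (S :\ v))) /=.
rewrite -[leLHS]addr0; apply: lerD; last by apply: sumr_ge0 => *; exact: expR_ge0.
rewrite le_eqVlt; apply/orP; left; apply/eqP; apply: eq_bigl => w.
by rewrite !inE; case: (w == v); case: (w \in S); case: (e u w).
Qed.

(** Lowering [z y] by [t] raises the rate of [y]. To first order its own term changes by
    [t * expR (- z y)] times the left side, and the terms of its neighbours lose at most
    [t * expR (- z y)] times the right side. No other term moves, so the gain cannot exceed the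
    loss. *)
Lemma potential_stationary S z y : y \in S -> (forall v, 0 <= z v) -> 0 < z y ->
  (forall t, 0 < t -> t <= z y ->
    potential S (fun v => if v == y then z y - t else z v) <= potential S z) ->
  c y * (z y - 1) / (wdeg S z y + s) <= \sum_(v in S | e y v) dpotential S z v.
Proof.
move=> yS z0 zy0 zmax.
set B := \sum_(v in S | e y v) _; set D := wdeg S z y + s.
have D0 : 0 < D by exact: wdegD_gt0.
have b0 v : 0 <= dpotential S z v.
  by rewrite divr_ge0 ?sqr_ge0 // !mulr_ge0 ?expR_ge0.
have B0 : 0 <= B by apply: sumr_ge0.
rewrite -subr_le0.
(* The slack [c y / D] comes from the [t ^+ 2] in [(1 + t) * (z y - t)], and [2 * B] from
   [expR_le_quadratic], which also requires the cap [2^-1]. *)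
apply: (@le0_of_le_small _ _ (c y / D + 2 * B) (Num.min (z y) 2^-1)).
  by rewrite lt_min zy0 /= invr_gt0.
move=> t t0; rewrite le_min => /andP[tz t2].
have := zmax t t0 tz; set z' := fun v => _.
have et1 : 0 <= expR t - 1 by have := @expR_ge1Dx R t; lra.
pose h := expR (- z y) * (expR t - 1).
have h0 : 0 <= h by rewrite mulr_ge0 // expR_ge0.
have xy' : expR (- z' y) = expR (- z y) * expR t.
  by rewrite /z' eqxx opprB addrC expRD.
have x' v : v != y -> z' v = z v by rewrite /z' => /negbTE ->.
have dN v : ~~ e v y -> wdeg S z' v = wdeg S z v.
  move=> evy; apply: eq_bigr => u /andP[_ evu]; rewrite x' //.
  by apply: contraNneq evy => <-.
have dY v : e v y -> wdeg S z' v = wdeg S z v + h.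
  move=> evy; rewrite /wdeg (bigD1 y) ?yS //= [in RHS](bigD1 y) ?yS //= xy'.
  rewrite (eq_bigr (fun u => expR (- z u))); last first.
    by move=> u /andP[_ uy]; rewrite x'.
  by rewrite /h; ring.
rewrite -subr_le0 /potential -sumrB (bigD1 y) //= xy' (dN y) ?e_irr //.
rewrite (bigID (e y)) /= [X in _ + (_ + X)]big1; last first.
  move=> v /andP[/andP[_ vy] evy]; rewrite x' // dN ?subrr //.
  by rewrite e_sym.
rewrite addr0 {1}/z' eqxx -/D => le1.
have le2 : - (h * B) <= \sum_(i | (i \in S) && (i != y) && e y i)
    (c i * (expR (- z' i) * z' i) / (wdeg S z' i + s) -
     c i * (expR (- z i) * z i) / (wdeg S z i + s)).
  rewrite mulr_sumr -sumrN.
  rewrite (eq_bigl (fun i => (i \in S) && (i != y) && e y i)); last first.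
    by move=> i; case: eqP => [->|]; rewrite ?e_irr ?andbF ?andbT.
  apply: ler_sum => v /andP[/andP[vS vy] eyv]; rewrite x' // dY 1?e_sym //.
  rewrite -mulrBr /dpotential addrAC.
  have := @invD_ge_tangent R (wdeg S z v + s) h (wdegD_gt0 _ _ _).
  rewrite ltr_wpDr ?wdegD_gt0 // => /(_ isT) le3.
  have -> : - (h * (c v * (expR (- z v) * z v) / (wdeg S z v + s) ^+ 2)) =
     c v * (expR (- z v) * z v) * (- (h / (wdeg S z v + s) ^+ 2)) by ring.
  by apply: ler_wpM2l; [rewrite !mulr_ge0 ?expR_ge0 | lra].
have {le1 le2} le4 := le_trans (lerD (lexx _) le2) le1.
have le5 : expR (- z y) * (1 + t) * (z y - t) <=
    expR (- z y) * expR t * (z y - t).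
  by rewrite ler_wpM2r ?subr_ge0 // ler_wpM2l ?expR_ge0 ?expR_ge1Dx.
have le6 : h * B <= expR (- z y) * (t * (1 + 2 * t)) * B.
  by rewrite ler_wpM2r // ler_wpM2l ?expR_ge0 // expR_le_quadratic // ltW.
have le7 : c y / D * (expR (- z y) * (1 + t) * (z y - t)) -
    c y / D * (expR (- z y) * z y) - expR (- z y) * (t * (1 + 2 * t)) * B <= 0.
  have cD : 0 <= c y / D by rewrite divr_ge0 // ltW.
  apply: le_trans le4.
  rewrite ![c y * _ / D]mulrAC lerB // lerD2r.
  exact: ler_wpM2l.
have : expR (- z y) * t * (c y * (z y - 1) / D - B - t * (c y / D + 2 * B)) <= 0.
  by apply: le_trans le7; rewrite le_eqVlt; apply/orP; left; apply/eqP; ring.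
by rewrite pmulr_rle0 ?mulr_gt0 ?expR_gt0 // subr_le0.
Qed.


Definition nonnbrs S u : {set T} := [set v in S | (v != u) && ~~ e u v].

(** The first two terms are the contributions lost with [u] and its neighbours. A surviving [v]
    loses from its degree the rates of its common neighbours with [u], and the tangent line bounds
    its gain from below. Without triangles this loss is 0 for neighbours of [u], so the negative sum
    may run over all of [S]; the last term corrects for [v = u]. *)
Lemma potential_nonnbrs S z u : u \in S -> (forall v, 0 <= z v) ->
  potential S z - potential (nonnbrs S u) z <=
  dpotential S z u * (wdeg S z u + s)
  + \sum_(v in S | e u v) dpotential S z v * (wdeg S z v + s)
  - \sum_(v in S) dpotential S z v * \sum_(y in S | e v y && e u y) expR (- z y)
  + dpotential S z u * wdeg S z u.
Proof.
move=> uS z0; pose m v := \sum_(y in S | e v y && e u y) expR (- z y).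
pose a v := dpotential S z v * (wdeg S z v + s).
have aE v : c v * (expR (- z v) * z v) / (wdeg S z v + s) = a v.
  by rewrite /a /dpotential; field; rewrite gt_eqF ?wdegD_gt0.
have mu : m u = wdeg S z u by apply: eq_bigl => y; rewrite andbb.
have mN v : e u v -> m v = 0.
  move=> euv; apply: big1 => y /and3P[_ evy euy].
  by case: (@e_tri u v y).
have dN v : v != u -> ~~ e u v -> wdeg S z v = wdeg (nonnbrs S u) z v + m v.
  move=> vu euv; rewrite /wdeg (bigID (e u)) /= addrC; congr (_ + _).
    apply: eq_bigl => y; rewrite !inE.
    case: (eqVneq y u) => [->|_]; last first.
      by rewrite -!andbA; congr (_ && _); rewrite andbC.
    by rewrite e_sym (negbTE euv) !andbF.
  by apply: eq_bigl => y; rewrite andbA.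
rewrite -/(a u) -[X in _ + _ - X + _]/(\sum_(v in S) dpotential S z v * m v).
have -> : potential (nonnbrs S u) z = \sum_(v in S)
    if (v != u) && ~~ e u v
    then c v * (expR (- z v) * z v) / (wdeg (nonnbrs S u) z v + s) else 0.
  by rewrite -big_mkcondr; apply: eq_bigl => v; rewrite inE.
rewrite [X in _ + X - _]big_mkcondr /= /potential -sumrB.
rewrite (bigD1 u) //= [X in _ + X - _](bigD1 u) //= [X in _ + _ - X](bigD1 u) //=.
rewrite eqxx e_irr /= aE mu subr0 add0r.
suff : \sum_(v in S | v != u) (c v * (expR (- z v) * z v) / (wdeg S z v + s) -
    (if (v != u) && ~~ e u v
     then c v * (expR (- z v) * z v) / (wdeg (nonnbrs S u) z v + s) else 0)) <=
  \sum_(v in S | v != u) (if e u v then a v else 0) -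
  \sum_(v in S | v != u) dpotential S z v * m v by rewrite -/(a _); lra.
rewrite -sumrB; apply: ler_sum => v /andP[vS vu]; rewrite vu /=.
case: ifPn => [/negbTE euv|]; last first.
  by rewrite negbK => euv; rewrite euv mN // mulr0 aE.
rewrite euv sub0r dN ?euv //.
have := @invD_ge_tangent R (wdeg S z v + s) (- m v) (wdegD_gt0 _ _ _).
have -> : wdeg S z v + s - m v = wdeg (nonnbrs S u) z v + s.
  by rewrite dN ?euv //; ring.
move=> /(_ (wdegD_gt0 _ _ _)); rewrite /dpotential -dN ?euv // => le1.
rewrite -mulrBr.
have -> : - (c v * (expR (- z v) * z v) / (wdeg S z v + s) ^+ 2 * m v) =
  c v * (expR (- z v) * z v) * (- (m v / (wdeg S z v + s) ^+ 2)) by ring.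
by apply: ler_wpM2l; [rewrite !mulr_ge0 ?expR_ge0 | lra].
Qed.

Lemma potential_descent S z (Z : R) : (forall v, 0 <= z v <= Z) ->
  (forall y, y \in S -> c y * (z y - 1) / (wdeg S z y + s) <=
     \sum_(v in S | e y v) dpotential S z v) ->
  \sum_(u in S) expR (- z u) * (potential S z - potential (nonnbrs S u) z) <=
  (1 + 2 * Z / s) * \sum_(u in S) expR (- z u) * c u.
Proof.
move=> zZ stat; have z0 v : 0 <= z v by case/andP: (zZ v).
pose x v := expR (- z v); pose b v := dpotential S z v; pose d v := wdeg S z v.
have x0 v : 0 <= x v by exact: expR_ge0.
have d0 v : 0 <= d v by exact: wdeg_ge0.
apply: (@le_trans _ _ (\sum_(u in S) x u * (b u * (d u + s) +
    \sum_(v in S | e u v) b v * (d v + s) -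
    \sum_(v in S) b v * \sum_(y in S | e v y && e u y) x y + b u * d u))).
  by apply: ler_sum => u uS; rewrite ler_wpM2l // potential_nonnbrs.
under eq_bigr do rewrite mulrDr mulrBr mulrDr.
rewrite big_split /= sumrB big_split /= adj_sum_exchange // -/(wdeg _ _).
(* Grouping the walks [u, y, v] by their middle vertex [y] produces the inner sum that [stat] bounds
   from below. *)
have -> : \sum_(u in S) x u *
      \sum_(v in S) b v * (\sum_(y in S | e v y && e u y) x y) =
    \sum_(y in S) x y * d y * \sum_(v in S | e y v) b v.
  rewrite -[RHS]adj_sum_exchange //.
  under eq_bigr do rewrite mulr_sumr.
  rewrite exchange_big /=; apply: eq_bigr => v _.
  under eq_bigr do rewrite mulrCA.
  rewrite -mulr_sumr; congr (_ * _).
  transitivity (\sum_(u in S) x u * \sum_(y in S | e u y)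
      (if e v y then x y else 0)).
    apply: eq_bigr => u _; congr (_ * _); rewrite -big_mkcondr /=.
    by apply: eq_bigl => y; rewrite -andbA; congr (_ && _); rewrite andbC.
  rewrite adj_sum_exchange // [RHS]big_mkcondr /=; apply: eq_bigr => y _.
  by case: ifP => _; rewrite ?mul0r.
have : \sum_(y in S) x y * d y * (c y * (z y - 1) / (d y + s)) <=
    \sum_(y in S) x y * d y * \sum_(v in S | e y v) b v.
  by apply: ler_sum => y yS; rewrite ler_wpM2l ?mulr_ge0 ?stat.
have : \sum_(u in S) x u * (b u * (d u + s)) +
    \sum_(v in S) b v * (d v + s) * d v +
    \sum_(u in S) x u * (b u * d u) -
    \sum_(y in S) x y * d y * (c y * (z y - 1) / (d y + s)) <=
    (1 + 2 * Z / s) * (\sum_(u in S) x u * c u); last first.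
  rewrite -/(d _); lra.
rewrite -!big_split -sumrB mulr_sumr /=; apply: ler_sum => v _.
have /andP[_ zv] := zZ v.
have D0 : 0 < d v + s by exact: wdegD_gt0.
have x1 : x v <= 1 by rewrite /x -[leRHS](@expR0 R) ler_expR oppr_le0.
(* The two terms [z v * d v / (d v + s)] cancel; what is left in the bracket is at most
   [1 + 2 * Z / s]. *)
have -> : x v * (b v * (d v + s)) + b v * (d v + s) * d v + x v * (b v * d v) -
    x v * d v * (c v * (z v - 1) / (d v + s)) =
    x v * c v * (d v / (d v + s) + x v * z v / (d v + s) * (1 + d v / (d v + s))).
  by rewrite /b /dpotential -/(x v) -/(d v); field; rewrite gt_eqF.
rewrite [leRHS]mulrC; apply: ler_wpM2l; first by rewrite mulr_ge0.
have le1 : d v / (d v + s) <= 1 by rewrite ler_pdivrMr // mul1r lerDl ltW.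
have le0 : 0 <= d v / (d v + s) by rewrite divr_ge0 // ltW.
have le2 : x v * z v / (d v + s) <= Z / s.
  apply: ler_pM; rewrite ?mulr_ge0 ?invr_ge0 ?(ltW D0) //.
    by rewrite -[leRHS]mul1r ler_pM.
  by rewrite lef_pV2 ?posrE // lerDr.
have -> : 2 * Z / s = Z / s * 2 by ring.
rewrite lerD // ler_pM //; last lra.
- by rewrite !mulr_ge0 // invr_ge0 ltW.
- by rewrite addr_ge0.
Qed.

Lemma potential_le_independent (Z : R) : 0 <= Z ->
  forall S z, (forall v, 0 <= z v <= Z) ->
  exists A : {set T}, [/\ independent e A, A \subset S &
    potential S z <= (1 + 2 * Z / s) * \sum_(v in A) c v].
Proof.
move=> Z0 S; move: {2}#|S|.+1 (ltnSn #|S|) => n.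
elim: n => // n IH in S *; rewrite ltnS => Sn z1 z1Z.
have [S0|[v0 v0S]] := set_0Vmem S.
  exists finset.set0; split; first by move=> x y; rewrite inE.
    exact: finset.sub0set.
  by rewrite /potential S0 !big_set0 mulr0.
pose X := prod_topology (fun _ : T => R : topologicalType).
have B0 : ([set f : X | forall i, (0 <= f i <= Z)%R] !=set0)%classic by exists z1.
(* The maximiser is chosen anew for each [S], since stationarity does not pass to subsets. *)
have [z /set_mem zZ zmax] := compact_EVT_max B0 (@box_compact R T 0 Z)
  (continuous_subspaceT (potential_continuous S)).
have z0 v : 0 <= z v by case/andP: (zZ v).
suff [A [iA AS le]] : exists A : {set T}, [/\ independent e A, A \subset S &
    potential S z <= (1 + 2 * Z / s) * \sum_(v in A) c v].
  exists A; split=> //; apply: le_trans le; apply: zmax; exact: mem_set.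
have [v /andP[vS /eqP zv]|zN0] := pickP [pred v | (v \in S) && (z v == 0)].
  have [|A [iA AS le]] := IH (S :\ v) _ z zZ.
    by move: Sn; rewrite (cardsD1 v) vS.
  exists A; split=> //; first exact: fintype.subset_trans AS (finset.subD1set _ _).
  by apply: le_trans le; exact: potential_drop.
have zgt0 y : y \in S -> 0 < z y.
  by move=> yS; rewrite lt_def z0 andbT; have := zN0 y; rewrite /= yS => /negbT.
have stat y : y \in S -> c y * (z y - 1) / (wdeg S z y + s) <=
    \sum_(v in S | e y v) dpotential S z v.
  move=> yS; apply: potential_stationary => //; first exact: zgt0.
  move=> t t0 tz; apply: zmax; apply: mem_set => v /=.
  case: eqP => // _; have := zZ y; lra.
have desc := @potential_descent S z Z zZ stat.
(* If every [u] failed, summing the strict inequalities with weights [expR (- z u)] over the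
   nonempty [S] would contradict [desc]. *)
have [u uS le] : exists2 u, u \in S & potential S z <=
    (1 + 2 * Z / s) * c u + potential (nonnbrs S u) z.
  apply: contrapT => nex; move: desc; apply/negP; rewrite -ltNge.
  rewrite mulr_sumr; apply: ltr_sum.
    by apply/hasP; exists v0 => //; exact: mem_index_enum.
  move=> u uS; rewrite mulrCA ltr_pM2l ?expR_gt0 // ltrBrDr ltNge.
  by apply/negP => le; apply: nex; exists u.
have [|A [iA AS leA]] := IH (nonnbrs S u) _ z zZ.
  apply: leq_trans Sn; apply: proper_card; apply/fintype.properP; split.
    by apply/fintype.subsetP => v; rewrite inE => /andP[].
  by exists u => //; rewrite inE eqxx /= andbF.
have AP v : v \in A -> [/\ v \in S, v != u & ~~ e u v].
  by move=> /(fintype.subsetP AS); rewrite inE => /and3P.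
exists (u |: A); split.
- move=> v w; rewrite !inE => /orP[/eqP->|vA] /orP[/eqP->|wA].
  + by rewrite e_irr.
  + by case: (AP w wA).
  + by rewrite e_sym; case: (AP v vA).
  + exact: iA.
- by rewrite finset.subUset finset.sub1set uS; apply/fintype.subsetP => v /AP[].
- rewrite big_setU1 /=; last by apply/negP => /AP[_]; rewrite eqxx.
  by rewrite mulrDr; apply: le_trans le _; rewrite lerD2l.
Qed.

End Potential.

(** * From the potential to a heavy independent set *)

Lemma weighted_shearer (R : realType) (T : finType) (e : rel T) (c : T -> R)
    (Z eps : R) :
  symmetric e -> irreflexive e -> triangle_free e -> (forall v, 0 <= c v) ->
  0 < Z -> 0 < eps ->
  exists2 A : {set T}, independent e A &
    Z * \sum_v c v / ((\sum_(u | e v u) 1) + 2 * Z * expR Z / eps) <=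
    (1 + eps) * \sum_(v in A) c v.
Proof.
(* This [s] makes [1 + 2 * Z / s] equal to [1 + eps]. *)
move=> e_sym e_irr e_tri c_ge0 Z0 eps0; pose s := 2 * Z / eps.
have s0 : 0 < s by rewrite !mulr_gt0 ?invr_gt0.
have [v|A [iA _ le]] := @potential_le_independent R T e c s e_sym e_irr e_tri
  c_ge0 s0 Z (ltW Z0) finset.setT (fun=> Z); first by rewrite lexx ltW.
exists A => //; move: le.
have -> : 1 + 2 * Z / s = 1 + eps by rewrite /s; field; rewrite !gt_eqF.
apply: le_trans; rewrite mulr_sumr /potential le_eqVlt; apply/orP; left.
apply/eqP; apply: eq_big => [v|v _]; first by rewrite inE.
set d := \sum_(u | e v u) _.
(* All rates equal [expR (- Z)]; this factor cancels against the numerator and turns [s] into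
   [s * expR Z]. *)
have -> : wdeg e finset.setT (fun=> Z) v = expR (- Z) * d.
  by rewrite mulr_sumr; apply: eq_big => u; rewrite ?inE ?mulr1.
rewrite expRN.
have d0 : 0 <= d by apply: sumr_ge0.
rewrite /s; field; rewrite !gt_eqF ?expR_gt0 //.
by rewrite ltr_wpDl ?mulr_ge0 ?(ltW eps0) // !mulr_gt0 ?expR_gt0.
Qed.

Lemma nbrs_independent (T : finType) (e : rel T) (v : T) :
  triangle_free e -> independent e [set u | e v u]%SET.
Proof.
move=> e_tri x y; rewrite !inE => evx evy; apply/negP => exy.
by case: (@e_tri v x y).
Qed.

Lemma exists_independent_weight (R : realType) (T : finType) (e : rel T)
    (t Z eps : R) (c : T -> R) :
  symmetric e -> irreflexive e -> triangle_free e -> (forall v, 0 <= c v) ->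
  0 < t -> 0 < Z -> 0 < eps ->
  (1 + eps) * t * (#|T|%:R * t + 2 * Z * expR Z / eps) <= Z ->
  exists2 A : {set T}, independent e A & t * \sum_v c v <= \sum_(v in A) c v.
Proof.
move=> e_sym e_irr e_tri c_ge0 t0 Z0 eps0 le.
apply: contrapT => nex.
set C := \sum_v c v in nex.
have small (A : {set T}) : independent e A -> \sum_(v in A) c v < t * C.
  by move=> iA; rewrite ltNge; apply/negP => h; apply: nex; exists A.
set S := 2 * Z * expR Z / eps in le.
have S0 : 0 < S by rewrite !mulr_gt0 ?invr_gt0 ?expR_gt0.
pose m : R := #|T|%:R * t + S.
have m0 : 0 < m by rewrite ltr_wpDl // mulr_ge0 // ltW.
(* The empty set is independent, so [small] gives [0 < t * C]. *)
have C0 : 0 < C.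
  have := small finset.set0; rewrite big_set0 pmulr_rgt0 //.
  by apply=> x y; rewrite inE.
pose d v : R := \sum_(u | e v u) 1.
have dge0 v : 0 <= d v by apply: sumr_ge0.
(* Double counting turns the sum into the total weight of all neighbourhoods, each independent and
   hence lighter than [t * C]. *)
have cd : \sum_v c v * d v <= #|T|%:R * (t * C).
  have -> : \sum_v c v * d v = \sum_v \sum_(u | e v u) c u.
    have := @adj_sum_exchange R T e finset.setT c (fun=> 1) e_sym.
    under eq_bigl do rewrite inE; under [in RHS]eq_bigl do rewrite inE.
    under eq_bigr do under eq_bigl do rewrite inE.
    move=> ->; apply: eq_bigr => v _; rewrite mul1r; apply: eq_bigl => u.
    by rewrite inE.
  have -> : #|T|%:R * (t * C) = \sum_(v : T) t * C.
    by rewrite sumr_const mulr_natl.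
  apply: ler_sum => v _; rewrite ltW //.
  have := small _ (@nbrs_independent T e v e_tri).
  by under eq_bigl do rewrite inE.
have [A iA leA] := @weighted_shearer R T e c Z eps e_sym e_irr e_tri c_ge0 Z0 eps0.
(* Jensen's inequality through the tangent of the inverse at [m]; its slope is negative, so the
   upper bound [cd] suffices. *)
have le1 : C / m <= \sum_v c v / (d v + S).
  apply: (@le_trans _ _
    (\sum_v (c v * (m^-1 - (S - m) / m ^+ 2) - c v * d v / m ^+ 2))).
    rewrite sumrB -!mulr_suml -/C.
    have -> : C / m = C * (m^-1 - (S - m) / m ^+ 2) - #|T|%:R * (t * C) / m ^+ 2.
      have -> : #|T|%:R * (t * C) = (m - S) * C by rewrite /m; ring.
      by field; rewrite gt_eqF.
    by rewrite lerD2l lerN2 ler_wpM2r // invr_ge0 sqr_ge0.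
  apply: ler_sum => v _; rewrite -[c v * d v / _]mulrA -mulrBr ler_wpM2l //.
  have := @invD_ge_tangent R m (d v + S - m) m0; rewrite addrCA subrr addr0.
  move=> /(_ (ltr_wpDl (dge0 v) S0)); apply: le_trans.
  by rewrite le_eqVlt; apply/orP; left; apply/eqP; field; rewrite gt_eqF.
have le2 : Z * (C / m) < (1 + eps) * (t * C).
  apply: le_lt_trans (le_trans (ler_wpM2l (ltW Z0) le1) leA) _.
  by rewrite ltr_pM2l ?small // ltr_pwDl // ltW.
move: le2; rewrite mulrA ltr_pdivrMr // mulrA mulrAC ltr_pM2r //.
by rewrite ltNge le.
Qed.

(** * Choice of parameters and conclusion *)

Lemma parameters_suffice (R : realType) (delta L t : R) : 0 < delta ->
  let eta := delta / (4 * (1 + delta)) in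
  let Z := (1 - eta) * L / 2 in
  16 / eta ^+ 4 <= L -> 0 < t ->
  t ^+ 2 = L / ((Num.sqrt 2 + delta) ^+ 2 * expR L) ->
  (1 + eta) * t * (expR L * t + 2 * Z * expR Z / eta) <= Z.
Proof.
move=> delta0 eta Z leL t0 t2.
have eta0 : 0 < eta by rewrite divr_gt0 // mulr_gt0 // addr_gt0.
have eta1 : eta < 1.
  by rewrite ltr_pdivrMr ?mulr_gt0 ?addr_gt0 // mul1r; lra.
(* [eta] is chosen for this identity: the factor [1 - 4 * eta] in the main term pays for [1 - eta]
   in [Z], the factor [1 + eta] and the error [Z * eta]. *)
have etaE : 1 - 4 * eta = (1 + delta)^-1.
  by rewrite /eta; field; rewrite gt_eqF ?addr_gt0.
clearbody eta.
have L0 : 0 < L by apply: lt_le_trans leL; rewrite divr_gt0 // exprn_gt0.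
have leL' : 16 <= eta ^+ 4 * L by rewrite mulrC -ler_pdivrMr // exprn_gt0.
have L1 : 1 <= L.
  apply: le_trans (_ : 16 <= L); first by rewrite ler1n.
  by apply: le_trans leL' _; rewrite ler_piMl ?exprn_ile1 ?ltW.
have Z0 : 0 < Z by rewrite !mulr_gt0 ?invr_gt0 // subr_gt0.
have sqrt2 : 1 <= Num.sqrt 2 :> R.
  by rewrite -[leLHS]sqrtr1 ler_sqrt // ler1n.
pose q := (Num.sqrt 2 + delta) ^+ 2.
have qge : 2 * (1 + delta) <= q.
  have -> : q = Num.sqrt 2 ^+ 2 + 2 * (Num.sqrt 2 * delta) + delta ^+ 2.
    by rewrite /q; ring.
  rewrite sqr_sqrtr //; have := sqr_ge0 delta.
  have : delta <= Num.sqrt 2 * delta by rewrite ler_peMl // ltW.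
  lra.
have q0 : 0 < q by apply: lt_le_trans qge; rewrite mulr_gt0 // addr_gt0.
have le1 : expR L * t ^+ 2 <= (1 - 4 * eta) * L / 2.
  have -> : expR L * t ^+ 2 = L / q.
    by rewrite t2 -/q; field; rewrite !gt_eqF ?expR_gt0.
  have -> : (1 - 4 * eta) * L / 2 = L / (2 * (1 + delta)).
    by rewrite etaE; field; rewrite gt_eqF ?addr_gt0.
  by rewrite ler_pM2l // lef_pV2 ?posrE // mulr_gt0 // addr_gt0.
(* A crude bound suffices: [Z] lies below [L / 2] by [eta * L / 2], so [expR Z * t] still decays
   exponentially in [L]. *)
have tle : t <= L * expR (- (L / 2)).
  rewrite -(@ler_pXn2r _ 2) ?nnegrE ?mulr_ge0 ?expR_ge0 ?(ltW t0) ?(ltW L0) //.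
  rewrite exprMn -expRM_natl mulrN -[2%:R * (L / 2)]mulrC divfK // expRN t2 -/q.
  apply: (@le_trans _ _ (L / expR L)).
    rewrite ler_wpM2l ?(ltW L0) // lef_pV2 ?posrE ?expR_gt0
      ?(mulr_gt0 q0 (expR_gt0 _)) //.
    by rewrite ler_peMl ?expR_ge0 //; lra.
  by rewrite ler_wpM2r ?invr_ge0 ?expR_ge0 // ler_eXnr.
have le2 : expR Z * t <= eta ^+ 2 / 2.
  apply: (@le_trans _ _ (L / expR (eta * L / 2))).
    apply: le_trans (ler_wpM2l (expR_ge0 _) tle) _.
    rewrite mulrCA -expRD -expRN le_eqVlt; apply/orP; left; apply/eqP.
    by congr (_ * expR _); rewrite /Z; field.
  rewrite ler_pdivrMr ?expR_gt0 //.
  have y0 : 0 <= eta * L / 2 by rewrite !mulr_ge0 ?invr_ge0 // ltW.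
  (* Index 1 gives the quadratic term of the exponential; the threshold [16 / eta ^+ 4] on [L] makes
     its contribution [eta ^+ 4 * L * L / 16] at least [L]. *)
  have := @expR_ge1Dxn R _ 1 y0; rewrite [1.+1`!]/= => ey.
  apply: (@le_trans _ _ (eta ^+ 2 / 2 * (1 + (eta * L / 2) ^+ 2 / 2))); last first.
    by rewrite ler_wpM2l // divr_ge0 // sqr_ge0.
  have : 16 * L <= eta ^+ 4 * L * L by rewrite ler_wpM2r // ltW.
  have -> : eta ^+ 2 / 2 * (1 + (eta * L / 2) ^+ 2 / 2) =
    eta ^+ 2 / 2 + eta ^+ 4 * L * L / 16 by field.
  have := sqr_ge0 eta; lra.
have le3 : t * (2 * Z * expR Z / eta) <= Z * eta.
  have -> : t * (2 * Z * expR Z / eta) = 2 * Z / eta * (expR Z * t) by ring.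
  have -> : Z * eta = 2 * Z / eta * (eta ^+ 2 / 2) by field; rewrite gt_eqF.
  by rewrite ler_wpM2l // divr_ge0 ?(ltW eta0) // mulr_ge0 // ltW.
have -> : (1 + eta) * t * (expR L * t + 2 * Z * expR Z / eta) =
  (1 + eta) * (expR L * t ^+ 2 + t * (2 * Z * expR Z / eta)) by ring.
apply: (@le_trans _ _ ((1 + eta) * ((1 - 4 * eta) * L / 2 + Z * eta))).
  by rewrite ler_wpM2l ?lerD // addr_ge0 // ltW.
rewrite -subr_ge0.
have -> : Z - (1 + eta) * ((1 - 4 * eta) * L / 2 + Z * eta) =
  L / 2 * (eta * (1 + 4 * eta + eta ^+ 2)) by rewrite /Z; field.
by rewrite !mulr_ge0 ?addr_ge0 ?mulr_ge0 ?sqr_ge0 ?invr_ge0 // ltW.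
Qed.

Theorem theorem1p4 (R : realType) (delta : R) (delta_gt0 : 0 < delta) :
  exists n0 : nat, forall (T : finType) (e : rel T),
    symmetric e -> irreflexive e -> triangle_free e -> (n0 <= #|T|)%N ->
    fractional_chromatic_number R e
      <= (Num.sqrt 2 + delta) * Num.sqrt (#|T|%:R / ln #|T|%:R).
Proof.
pose eta := delta / (4 * (1 + delta)).
have eta_gt0 : 0 < eta by rewrite divr_gt0 // mulr_gt0 // addr_gt0.
have eta_lt1 : eta < 1.
  by rewrite ltr_pdivrMr ?mulr_gt0 ?addr_gt0 // mul1r; lra.
(* From this size on, [ln n] reaches the threshold [16 / eta ^+ 4] of [parameters_suffice]. *)
exists (Num.bound (expR (16 / eta ^+ 4))) => T e e_sym e_irr e_tri nT.
set n : R := #|T|%:R; set L := ln n; set r := _ * Num.sqrt _.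
have expLn : expR (16 / eta ^+ 4) <= n.
  apply: le_trans (ltW (archi_boundP (expR_ge0 _))) _.
  by rewrite ler_nat.
have n0 : 0 < n by apply: lt_le_trans expLn; exact: expR_gt0.
have leL : 16 / eta ^+ 4 <= L by rewrite -[leLHS]expRK ler_ln ?posrE ?expR_gt0.
have L0 : 0 < L by apply: lt_le_trans leL; rewrite divr_gt0 // exprn_gt0.
have eL : expR L = n by rewrite lnK.
have sqrt2 : 1 <= Num.sqrt 2 :> R by rewrite -[leLHS]sqrtr1 ler_sqrt // ler1n.
have r_ge1 : 1 <= r.
  rewrite -[leLHS]mulr1 ler_pM //; first lra.
  rewrite -[leLHS]sqrtr1 ler_sqrt; last by rewrite divr_ge0 ?ltW.
  rewrite ler_pdivlMr // mul1r -eL.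
  by apply: le_trans (expR_ge1Dx L); rewrite lerDr.
have r_gt0 : 0 < r by exact: lt_le_trans r_ge1.
have [_] := fractional_chromatic_number_min R e_irr; apply; split=> //.
apply: independent_dist_of_weights => c c_ge0.
apply: (@exists_independent_weight R T e r^-1 ((1 - eta) * L / 2) eta) => //.
- by rewrite invr_gt0.
- by rewrite !mulr_gt0 ?invr_gt0 // subr_gt0.
rewrite -/n -eL; apply: parameters_suffice => //; first by rewrite invr_gt0.
by rewrite /r eL exprVn exprMn sqr_sqrtr ?divr_ge0 ?ltW // mulrA invf_div.
Qed.
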